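(* Let $\mathcal A$ be a finite alphabet, $X\subset\mathcal A^{\mathbb Z}$ a bi-sided subshift, and $X_\infty\subset X$ a closed $\tau$-invariant subset. Let $\{M_i:i\in I\}$ be a net of clopen subsets of $X$ such that $X_\infty\subset M_i$ for every $i$ and $M_i\to X_\infty$ in the Fell topology of $\mathrm{Cl}(X)$. Let $h\in C_c(X\times\mathbb Z)$ be self-adjoint, i.e. $h(\tau_k(x),-k)=\overline{h(x,k)}$ for all $x\in X$, $k\in\mathbb Z$. Then $$\inf_{x\in X_\infty}\inf\mathrm{sp}(\mathsf H^{X_\infty}_x)=\sup_{i\in I}\Big[\inf_{y\in M_i}\inf\mathrm{sp}(\mathsf H^{M_i}_y)\Big],\qquad \sup_{x\in X_\infty}\sup\mathrm{sp}(\mathsf H^{X_\infty}_x)=\inf_{i\in I}\Big[\sup_{y\in M_i}\sup\mathrm{sp}(\mathsf H^{M_i}_y)\Big].$$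
   Context: $\mathcal A^{\mathbb Z}$ carries the product topology ($\mathcal A$ discrete) and the shift action $\tau_k(x)=x(\cdot-k)$, $k\in\mathbb Z$. A bi-sided subshift is a closed $\tau$-invariant subset $X\subset\mathcal A^{\mathbb Z}$. For a closed (possibly non-invariant) $N\subset X$ and $x\in N$, $\mathbb Z_x(N):=\{k\in\mathbb Z:\tau_k(x)\in N\}$, and $\mathsf H^N_x\in\mathbb B[\ell^2(\mathbb Z_x(N))]$ is defined by $[\mathsf H^N_x(v)](k)=\sum_{l\in\mathbb Z_x(N)}h(\tau_l(x),k-l)v(l)$, $k\in\mathbb Z_x(N)$. The Fell topology on the set $\mathrm{Cl}(X)$ of closed subsets of $X$ has basic open sets $\{A:A\cap K=\emptyset,\ A\cap\mathcal O\ne\emptyset\ \forall\mathcal O\in\mathfrak O\}$, $K$ compact, $\mathfrak O$ a finite family of open sets. *)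

(* Defs.v *)
From HB Require Import structures.
From mathcomp Require Import all_boot all_order all_algebra.
From mathcomp Require Import all_classical all_reals all_analysis.
From mathcomp Require Import complex.

Set Implicit Arguments. Unset Strict Implicit. Unset Printing Implicit Defensive.
Import Order.TTheory GRing.Theory Num.Theory.
Local Open Scope classical_set_scope.
Local Open Scope ring_scope.

Notation cfg A := (prod_topology (fun _ : int => discrete_topology A)).

Definition tau (A : finType) (k : int) (x : cfg A) : cfg A := fun j => x (j - k).

Definition shift_invariant (A : finType) (Y : set (cfg A)) :=
  forall (k : int) (x : cfg A), Y x -> Y (tau k x).

Definition subshift (A : finType) (X : set (cfg A)) :=
  closed X /\ shift_invariant X.

Definition rel_open (A : finType) (X O : set (cfg A)) :=
  exists U : set (cfg A), open U /\ O = U `&` X.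
Definition rel_closed (A : finType) (X F : set (cfg A)) :=
  exists C : set (cfg A), closed C /\ F = C `&` X.
Definition clopen_in (A : finType) (X M : set (cfg A)) :=
  M `<=` X /\ rel_open X M /\ rel_closed X M.

Definition directed_set (I : Type) (le : I -> I -> Prop) :=
  inhabited I /\ (forall i, le i i) /\
  (forall i j k, le i j -> le j k -> le i k) /\
  (forall i j, exists k, le i k /\ le j k).

(** Convergence of the net (M i) to L in the Fell topology of Cl(X):
    every basic open neighbourhood
      {B : B meets no point of K, B meets every O_j (j < n)}
    of L (K compact in X, O_0..O_{n-1} open in X) eventually contains M i. *)
Definition fell_cvg (A : finType) (X : set (cfg A)) (I : Type)
    (le : I -> I -> Prop) (M : I -> set (cfg A)) (L : set (cfg A)) :=
  forall (K : set (cfg A)) (n : nat) (O : nat -> set (cfg A)),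
    K `<=` X -> compact K ->
    (forall j, (j < n)%N -> rel_open X (O j)) ->
    L `&` K = set0 -> (forall j, (j < n)%N -> L `&` O j !=set0) ->
    exists i0 : I, forall i, le i0 i ->
      M i `&` K = set0 /\ (forall j, (j < n)%N -> M i `&` O j !=set0).

Definition Zx (A : finType) (N : set (cfg A)) (x : cfg A) : set int :=
  [set k | N (tau k x)].

Section Operators.
Variables (R : realType) (A : finType).

Definition sqn (z : R[i]) : R := (complex.Re z) ^+ 2 + (complex.Im z) ^+ 2.

Definition psum (n : nat) (v : int -> R[i]) : R :=
  \sum_(j < (2 * n).+1) sqn (v ((j : nat)%:Z - n%:Z)).

Definition l2 (S : set int) (v : int -> R[i]) :=
  (forall k, ~ S k -> v k = 0) /\ exists B : R, forall n, psum n v <= B.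

Definition resolvent_pt (S : set int)
    (T : (int -> R[i]) -> (int -> R[i])) (lam : R[i]) :=
  exists G : (int -> R[i]) -> (int -> R[i]),
    (forall v, l2 S v -> l2 S (G v)) /\
    (forall v, l2 S v -> G (fun k => T v k - lam * v k) = v) /\
    (forall v, l2 S v -> (fun k => T (G v) k - lam * G v k) = v) /\
    (exists C : R, forall v, l2 S v -> forall B : R,
        (forall n, psum n v <= B) -> forall n, psum n (G v) <= C * B).

Definition spectrum (S : set int) (T : (int -> R[i]) -> (int -> R[i])) :
  set R[i] := [set lam | ~ resolvent_pt S T lam].

(** H^N_x, for h : X x Z -> C with h(., k) = 0 for |k| > r:
    (H v)(k) = sum_{l in Z_x(N)} h(tau_l x, k - l) v(l), k in Z_x(N);
    only the l with |k - l| <= r contribute, so the sum is the finite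
    sum over l = k - r, ..., k + r. *)
Definition Hop (h : cfg A -> int -> R[i]) (r : nat) (N : set (cfg A))
    (x : cfg A) (v : int -> R[i]) : int -> R[i] :=
  fun k => if `[< Zx N x k >] then
    \sum_(j < (2 * r).+1)
      (let l := k - r%:Z + (j : nat)%:Z in
       if `[< Zx N x l >] then h (tau l x) (k - l) * v l else 0)
  else 0.

(** inf sp(H^N_x) and sup sp(H^N_x) (the spectrum of a self-adjoint operator
    is real, so we range over its real points). *)
Definition inf_sp (h : cfg A -> int -> R[i]) (r : nat) (N : set (cfg A))
    (x : cfg A) : \bar R :=
  ereal_inf [set (t%:E)%E | t in [set t : R | spectrum (Zx N x) (Hop h r N x) (t%:C)%C]].
Definition sup_sp (h : cfg A -> int -> R[i]) (r : nat) (N : set (cfg A))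
    (x : cfg A) : \bar R :=
  ereal_sup [set (t%:E)%E | t in [set t : R | spectrum (Zx N x) (Hop h r N x) (t%:C)%C]].

Definition cont_on_XZ (X : set (cfg A)) (h : cfg A -> int -> R[i]) :=
  forall (k : int) (x : cfg A), X x -> forall eps : R, 0 < eps ->
    exists U : set (cfg A), nbhs x U /\
      forall y, U y -> X y -> `|h y k - h x k| < (eps%:C)%C.

Definition self_adjoint (X : set (cfg A)) (h : cfg A -> int -> R[i]) :=
  forall (x : cfg A) (k : int), X x -> h (tau k x) (- k) = (h x k)^*.

End Operators.

(* Main.v *)
(** For a self-adjoint banded operator [H] on l2(S), a real [t] is a lower bound of
    the spectrum iff [t |w|^2 <= <H w, w>] for all finitely supported [w] on [S]:
    coercivity of [H - t] makes the iteration [u := u - s (H u - t u - w)] converge,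
    and conversely a positive [H - t] with a bounded inverse is coercive.

    Averaging a finitely supported [w] over all translates of a window of length [L]
    shows that, up to an error [O(1/L)], the form of [H^{M_i}_y] is bounded below as
    soon as it is on vectors supported in such a window.  By Fell convergence, for a
    suitable [i] every point of [M_i] has, along the window, potential values
    uniformly close to those of a point of [X_inf]; since [X_inf] is invariant, the
    window vector is also admissible for [H^{X_inf}_x], which bounds the form.  The
    other inequality holds because [H^{M_i}_x = H^{X_inf}_x] for [x] in [X_inf], and
    the statement on suprema is the one on infima for [-h]. *)

Require Import Defs.
From HB Require Import structures.
From mathcomp Require Import all_boot all_order all_algebra.
From mathcomp Require Import all_classical all_reals all_analysis.
From mathcomp Require Import complex.
From mathcomp Require Import zify ring lra.
Import Order.TTheory GRing.Theory Num.Theory numFieldNormedType.Exports.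
Local Open Scope classical_set_scope.
Local Open Scope ring_scope.

Set Implicit Arguments. Unset Strict Implicit. Unset Printing Implicit Defensive.

(** * Finite window sums over the integers *)

Section Windows.
Variable R : realType.
Implicit Types (F G : int -> R) (n m N : nat).

(** The enumeration by [j - n] with [j < 2n + 1] is that of [psum], and after a shift that of [Hop],
    so both become window sums. *)
Definition wseq n : seq int := [seq (j : nat)%:Z - n%:Z | j <- iota 0 (2 * n).+1].

Definition win n F : R := \sum_(k <- wseq n) F k.

Lemma mem_wseq n (k : int) : (k \in wseq n) = (`|k| <= n)%N.
Proof.
apply/mapP/idP => [[j]|kn]; first by rewrite mem_iota => ? ->; lia.
by exists (absz (k + n%:Z)%R); rewrite ?mem_iota; lia.
Qed.

Lemma wseq_uniq n : uniq (wseq n).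
Proof. by rewrite map_inj_uniq ?iota_uniq // => i j; lia. Qed.

Lemma size_wseq n : size (wseq n) = (2 * n).+1.
Proof. by rewrite size_map size_iota. Qed.

(** Once the zero terms are dropped, the two lists are permutations of each other. The reindexings
    of window sums below reduce to this. *)
Lemma big_uniq_support (s t : seq int) F : uniq s -> uniq t ->
  (forall k, F k != 0 -> (k \in s) = (k \in t)) ->
  \sum_(k <- s) F k = \sum_(k <- t) F k.
Proof.
move=> us ut st; rewrite (bigID (fun k => F k == 0)) /= big1 ?add0r; last first.
  by move=> ? /eqP.
rewrite [RHS](bigID (fun k => F k == 0)) /= [X in _ = X + _]big1 ?add0r; last by move=> ? /eqP.
rewrite -big_filter -[RHS]big_filter; apply: perm_big.
apply: uniq_perm; rewrite ?filter_uniq // => k; rewrite !mem_filter.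
by have [//|/st ->] := eqVneq (F k) 0.
Qed.

Lemma ler_big_uniq (s t : seq int) F : uniq s -> uniq t -> {subset s <= t} ->
  (forall k, 0 <= F k) -> \sum_(k <- s) F k <= \sum_(k <- t) F k.
Proof.
move=> us ut st F0.
have -> : \sum_(k <- s) F k = \sum_(k <- s) (if k \in s then F k else 0).
  by apply: eq_big_seq => k ->.
rewrite (@big_uniq_support s t) //.
  by apply: ler_sum => k _; case: ifP.
by move=> k; case: ifP => [ks _|]; rewrite ?eqxx // (st _ ks).
Qed.

Lemma eq_win n F G : (forall k, (`|k| <= n)%N -> F k = G k) -> win n F = win n G.
Proof. by move=> FG; apply: eq_big_seq => k; rewrite mem_wseq; apply: FG. Qed.

Lemma ler_win n F G : (forall k, (`|k| <= n)%N -> F k <= G k) ->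
  win n F <= win n G.
Proof.
move=> FG; rewrite /win big_seq [leRHS]big_seq; apply: ler_sum => k.
by rewrite mem_wseq; apply: FG.
Qed.

Lemma winD n F G : win n (fun k => F k + G k) = win n F + win n G.
Proof. exact: big_split. Qed.

Lemma winB n F G : win n (fun k => F k - G k) = win n F - win n G.
Proof. exact: sumrB. Qed.

Lemma winZ n (c : R) F : win n (fun k => c * F k) = c * win n F.
Proof. by rewrite /win mulr_sumr. Qed.

Lemma win_cst n (c : R) : win n (fun=> c) = (2 * n).+1%:R * c.
Proof. by rewrite /win big_const_seq count_predT size_wseq iter_addr_0 mulr_natl. Qed.

Lemma win0 n : win n (fun=> 0) = 0.
Proof. by rewrite win_cst mulr0. Qed.

Lemma win_ge0 n F : (forall k, 0 <= F k) -> 0 <= win n F.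
Proof. by move=> F0; apply: sumr_ge0. Qed.

Lemma win_exchange n m (F : int -> int -> R) :
  win n (fun k => win m (F k)) = win m (fun l => win n (fun k => F k l)).
Proof. exact: exchange_big. Qed.

Lemma win_eq n N F : (n <= N)%N -> (forall k, (n < `|k|)%N -> F k = 0) ->
  win N F = win n F.
Proof.
move=> nN F0; apply: big_uniq_support; rewrite ?wseq_uniq // => k.
rewrite !mem_wseq; have [|/F0->] := leqP `|k|%N n; last by rewrite eqxx.
by move=> kn _; lia.
Qed.

Lemma win_shift n N (m : int) F : (n + `|m| <= N)%N ->
  (forall k, (n < `|k|)%N -> F k = 0) -> win N (fun k => F (k + m)) = win n F.
Proof.
move=> nN F0; rewrite /win -[LHS](big_map (fun k => k + m) xpredT F).
apply: big_uniq_support; rewrite ?wseq_uniq //.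
  by rewrite map_inj_uniq ?wseq_uniq // => i j /addIr.
move=> k; have [kn _|/F0->] := leqP `|k|%N n; last by rewrite eqxx.
rewrite mem_wseq kn; apply/mapP; exists (k - m); last by rewrite subrK.
by rewrite mem_wseq; lia.
Qed.

Lemma win_shift_le n N (m : int) F : (n + `|m| <= N)%N ->
  (forall k, 0 <= F k) -> win n (fun k => F (k + m)) <= win N F.
Proof.
move=> nN F0; rewrite /win -[leLHS](big_map (fun k => k + m) xpredT F).
apply: ler_big_uniq; rewrite ?wseq_uniq //.
  by rewrite map_inj_uniq ?wseq_uniq // => i j /addIr.
by move=> _ /mapP[k + ->]; rewrite !mem_wseq; lia.
Qed.

Lemma win_le n N F : (n <= N)%N -> (forall k, 0 <= F k) -> win n F <= win N F.
Proof.
move=> nN F0; apply: ler_big_uniq; rewrite ?wseq_uniq // => k.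
by rewrite !mem_wseq; lia.
Qed.

Lemma win_opp n F : win n (fun k => F (- k)) = win n F.
Proof.
rewrite /win -[LHS](big_map -%R xpredT F).
apply: big_uniq_support; rewrite ?wseq_uniq //.
  by rewrite map_inj_uniq ?wseq_uniq // => i j /oppr_inj.
move=> k _; rewrite mem_wseq; apply/mapP/idP => [[j + ->]|kn].
  by rewrite mem_wseq abszN.
by exists (- k); rewrite ?opprK // mem_wseq abszN.
Qed.

Lemma win_ge_term n (k : int) F : (`|k| <= n)%N -> (forall k, 0 <= F k) ->
  F k <= win n F.
Proof.
move=> kn F0; rewrite -(big_seq1 +%R k F); apply: ler_big_uniq => //.
  exact: wseq_uniq.
by move=> j; rewrite inE mem_wseq => /eqP ->.
Qed.

(* Translates of an interval of length [L] that contain both [k] and [k + m]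
   start in [max(k, k + m) - L + 1, min(k, k + m)]. *)
Lemma win_count n (L N : nat) (k m : int) : (`|k| <= n)%N -> (`|m| <= L)%N ->
  (n + 2 * L <= N)%N ->
  win N (fun b => ((b <= k < b + L%:Z) && (b <= k + m < b + L%:Z))%R%:R) =
  L%:R - `|m|%:R.
Proof.
move=> kn mL nN; pose t : seq int := [seq Order.min k (k + m) - j%:Z | j <- iota 0 (L - `|m|)].
have tu : uniq t by rewrite map_inj_uniq ?iota_uniq // => i j; lia.
rewrite -natrB // (_ : (L - `|m|)%N = size t); last by rewrite size_map size_iota.
have memt (b : int) : (b \in t) = ((b <= k < b + L%:Z) && (b <= k + m < b + L%:Z))%R.
  apply/mapP/idP => [[j]|].
    by rewrite mem_iota => jL ->; case: leP => ?; lia.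
  move=> bP; exists (absz (Order.min k (k + m) - b)%R); rewrite ?mem_iota;
    by case: leP => ?; lia.
rewrite /win; under eq_bigr do rewrite -memt.
rewrite (@big_uniq_support _ t) ?wseq_uniq //; last first.
  move=> b; case bt : (b \in t); rewrite ?eqxx // mem_wseq => _.
  by move: bt; rewrite memt; lia.
rewrite (eq_big_seq (fun=> 1)); last by move=> b ->.
by rewrite big_const_seq count_predT iter_addr_0.
Qed.

End Windows.

(** * Square norms and the real inner product of the complex numbers *)

Section Complex.
Variable R : realType.
Implicit Types (z u v : R[i]).

(** Real part of the Hermitian inner product; real bilinearity is enough for quadratic forms of
    self-adjoint operators. *)
Definition ip u v : R := complex.Re u * complex.Re v + complex.Im u * complex.Im v.

Lemma sqnE z : sqn z = ip z z.
Proof. by rewrite /sqn /ip !expr2. Qed.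

Lemma ipC u v : ip u v = ip v u.
Proof. by rewrite /ip mulrC [X in _ + X]mulrC. Qed.

Lemma ipDl u v z : ip (u + v) z = ip u z + ip v z.
Proof. by case: u v z => [a b] [c d] [e f]; rewrite /ip /=; ring. Qed.

Lemma ipBl u v z : ip (u - v) z = ip u z - ip v z.
Proof. by case: u v z => [a b] [c d] [e f]; rewrite /ip /=; ring. Qed.

Lemma ipBr u v z : ip z (u - v) = ip z u - ip z v.
Proof. by rewrite !(ipC z) ipBl. Qed.

Lemma ip0l z : ip 0 z = 0.
Proof. by rewrite /ip /= !mul0r addr0. Qed.

Lemma ip0r z : ip z 0 = 0.
Proof. by rewrite ipC ip0l. Qed.

Lemma ipZl (s : R) u v : ip (s%:C%C * u) v = s * ip u v.
Proof. by case: u v => [a b] [c d]; rewrite /ip /=; ring. Qed.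

Lemma ipZr (s : R) u v : ip u (s%:C%C * v) = s * ip u v.
Proof. by rewrite !(ipC u) ipZl. Qed.

Lemma ip_conj z u v : ip (z * u) v = ip u (z^* * v).
Proof. by case: z u v => [e f] [a b] [c d]; rewrite /ip /=; ring. Qed.

Lemma ip_suml (I : Type) (s : seq I) (P : pred I) (F : I -> R[i]) z :
  ip (\sum_(i <- s | P i) F i) z = \sum_(i <- s | P i) ip (F i) z.
Proof.
by elim/big_rec2: _ => [|i x y _ <-]; rewrite ?ip0l // ipDl.
Qed.

Lemma sqn_ge0 z : 0 <= sqn z.
Proof. by rewrite addr_ge0 ?sqr_ge0. Qed.

Lemma sqn0 : sqn (0 : R[i]) = 0.
Proof. by rewrite sqnE ip0l. Qed.

Lemma sqn_eq0 z : sqn z = 0 -> z = 0.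
Proof.
case: z => a b; rewrite /sqn /= => /eqP; rewrite paddr_eq0 ?sqr_ge0 // !sqrf_eq0.
by case/andP => /eqP -> /eqP ->.
Qed.

Lemma ReB u v : complex.Re (u - v) = complex.Re u - complex.Re v.
Proof. by case: u v => [a b] [c d]. Qed.

Lemma ImB u v : complex.Im (u - v) = complex.Im u - complex.Im v.
Proof. by case: u v => [a b] [c d]. Qed.

Lemma sqr_ReB_le u v : (complex.Re u - complex.Re v) ^+ 2 <= sqn (u - v).
Proof. by rewrite -ReB /sqn lerDl sqr_ge0. Qed.

Lemma sqr_ImB_le u v : (complex.Im u - complex.Im v) ^+ 2 <= sqn (u - v).
Proof. by rewrite -ImB /sqn lerDr sqr_ge0. Qed.

Lemma sqnN z : sqn (- z) = sqn z.
Proof. by case: z => a b; rewrite /sqn /= !sqrrN. Qed.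

Lemma sqnM u v : sqn (u * v) = sqn u * sqn v.
Proof. by case: u v => [a b] [c d]; rewrite /sqn /=; ring. Qed.

Lemma sqnZ (s : R) z : sqn (s%:C%C * z) = s ^+ 2 * sqn z.
Proof. by rewrite sqnM /sqn /= expr0n addr0. Qed.

Lemma sqnB u v : sqn (u - v) = sqn u - 2 * ip u v + sqn v.
Proof. by rewrite !sqnE ipBl !ipBr (ipC v u); ring. Qed.

Lemma ip_le u v : 2 * ip u v <= sqn u + sqn v.
Proof. by have := sqn_ge0 (u - v); rewrite sqnB; lra. Qed.

Lemma ip_young (e : R) u v : 0 < e -> 2 * ip u v <= e * sqn u + e^-1 * sqn v.
Proof.
move=> e0; have := ip_le (e%:C%C * u) v; rewrite ipZl sqnZ => H.
have e_neq0 : e != 0 by rewrite gt_eqF.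
rewrite (_ : 2 * ip u v = e^-1 * (2 * (e * ip u v))); last by field.
rewrite (_ : e * sqn u + e^-1 * sqn v = e^-1 * (e ^+ 2 * sqn u + sqn v)); last by field.
by apply: ler_wpM2l => //; rewrite invr_ge0 ltW.
Qed.

Lemma sqnB_le u v : sqn (u - v) <= 2 * sqn u + 2 * sqn v.
Proof.
have := sqn_ge0 (u - - v); rewrite !sqnB sqnN -[- v]sub0r ipBr ip0r.
by lra.
Qed.

(** Young's inequality with weight [c^-1] balances the two terms; applying it to [u] and to [- u]
    gives the absolute value. *)
Lemma ip_norm_young (c : R) (a : R[i]) u v : 0 < c -> sqn a <= c ^+ 2 ->
  `|ip (a * u) v| <= c * (sqn u + sqn v).
Proof.
move=> c0 ac.
have H w : 2 * ip (a * w) v <= c * (sqn w + sqn v).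
  have ci0 : 0 < c^-1 by rewrite invr_gt0.
  apply: le_trans (ip_young _ _ ci0) _; rewrite invrK sqnM (mulrDr c (sqn w) (sqn v)).
  apply: lerD => //; rewrite mulrA; apply: ler_wpM2r; first exact: sqn_ge0.
  by rewrite ler_pdivrMl // -expr2.
have H1 := H u; have := H (- u); rewrite sqnN mulrN -[- (a * u)]sub0r ipBl ip0l sub0r.
have := sqn_ge0 u; have := sqn_ge0 v => v0 u0 H2.
have : 0 <= c * (sqn u + sqn v) by apply: mulr_ge0; [exact: ltW|exact: addr_ge0].
move: H1 H2; set p := ip (a * u) v; set q := c * _ => H1 H2 q0.
by rewrite ler_norml; apply/andP; split; lra.
Qed.

(** Cauchy-Schwarz, by expanding the square and bounding each mixed term with [ip_le]. *)
Lemma sqn_sum (I : Type) (s : seq I) (F : I -> R[i]) :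
  sqn (\sum_(i <- s) F i) <= (size s)%:R * \sum_(i <- s) sqn (F i).
Proof.
rewrite sqnE ip_suml.
have -> : \sum_(i <- s) ip (F i) (\sum_(i <- s) F i) =
  \sum_(i <- s) \sum_(j <- s) ip (F i) (F j).
  by apply: eq_bigr => i _; rewrite ipC ip_suml; apply: eq_bigr => j _; rewrite ipC.
apply: (@le_trans _ _ (\sum_(i <- s) \sum_(j <- s) 2^-1 * (sqn (F i) + sqn (F j)))).
  apply: ler_sum => i _; apply: ler_sum => j _.
  by have := ip_le (F i) (F j); lra.
under eq_bigr do rewrite -mulr_sumr big_split /= big_const_seq count_predT
  iter_addr_0.
rewrite -mulr_sumr big_split /= sumrMnl big_const_seq count_predT iter_addr_0.
by rewrite -[_ *+ size s]mulr_natl; set p := _%:R * _; lra.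
Qed.

End Complex.

(** * Square sums over windows, truncation and entrywise limits *)

Section Psum.
Variable R : realType.
Implicit Types (u v : int -> R[i]) (n N : nat).

Definition fin n v := forall k, (n < `|k|)%N -> v k = 0.

Lemma psumE n v : psum n v = win n (fun k => sqn (v k)).
Proof.
rewrite /win big_map /psum.
by rewrite -(big_mkord xpredT (fun j => sqn (v (j%:Z - n%:Z)))) /index_iota subn0.
Qed.

(* Otherwise rewriting with lemmas on [_ + _] or [_ * _] unfolds [sqn] and [ip]. *)
Opaque sqn ip.

Lemma psum_ge0 n v : 0 <= psum n v.
Proof. by rewrite psumE; apply: win_ge0 => k; apply: sqn_ge0. Qed.

Lemma psum_le n N v : (n <= N)%N -> psum n v <= psum N v.
Proof. by rewrite !psumE => /win_le; apply => k; apply: sqn_ge0. Qed.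

Lemma psum_fin n N v : (n <= N)%N -> fin n v -> psum N v = psum n v.
Proof. by rewrite !psumE => nN vn; apply: win_eq => // k /vn ->; apply: sqn0. Qed.

Lemma psum_fin_le n N v : fin n v -> psum N v <= psum n v.
Proof.
move=> vn; have [nN|/ltnW/psum_le//] := leqP n N.
by rewrite (psum_fin nN vn).
Qed.

Lemma psum_ge_term n v k : (`|k| <= n)%N -> sqn (v k) <= psum n v.
Proof.
rewrite psumE => kn.
by apply: (@win_ge_term _ _ k (fun k => sqn (v k))) => // j; apply: sqn_ge0.
Qed.

Lemma eq_psum n u v : (forall k, (`|k| <= n)%N -> u k = v k) -> psum n u = psum n v.
Proof. by rewrite !psumE => uv; apply: eq_win => k /uv ->. Qed.

Lemma psumN n v : psum n (fun k => - v k) = psum n v.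
Proof. by rewrite !psumE; apply: eq_win => k _; rewrite sqnN. Qed.

Definition trunc n v k := if (`|k| <= n)%N then v k else 0.

Lemma trunc_fin n v : fin n (trunc n v).
Proof. by move=> k; rewrite /trunc ltnNge => /negbTE ->. Qed.

Lemma psum_trunc n v : psum n (trunc n v) = psum n v.
Proof. by apply: eq_psum => k kn; rewrite /trunc kn. Qed.

(** The increments are dominated by a geometric sequence of ratio [Num.sqrt q], so the telescoping
    series converges absolutely. *)
Lemma cvg_geometric_increments (f : nat -> R) (M q : R) : 0 <= q < 1 -> 0 <= M ->
  (forall n, (f n.+1 - f n) ^+ 2 <= M * q ^+ n) -> cvgn f.
Proof.
move=> /andP[q0 q1] M0 fM.
have sq1 : Num.sqrt q < 1 by rewrite -(@sqrtr1 R) ltr_sqrt.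
have -> : f = (fun n => f 0%N + series (telescope f) n).
  by apply/funext => n; apply: eq_sum_telescope.
apply: is_cvgD; first exact: is_cvg_cst.
apply: normed_cvg.
apply: (@series_le_cvg _ _ (geometric (Num.sqrt M) (Num.sqrt q))) => [n|n|n|].
- exact: normr_ge0.
- by rewrite /geometric /= mulr_ge0 ?exprn_ge0 ?sqrtr_ge0.
- have p0 : 0 <= Num.sqrt M * Num.sqrt q ^+ n.
    by rewrite mulr_ge0 ?exprn_ge0 ?sqrtr_ge0.
  rewrite /geometric /= -ler_sqr ?nnegrE ?normr_ge0 //.
  rewrite real_normK ?num_real // exprMn exprAC !sqr_sqrtr //; exact: fM.
- by apply: is_cvg_geometric_series; rewrite ger0_norm ?sqrtr_ge0.
Qed.

Transparent sqn.
Lemma cvg_psum n (f : nat -> int -> R[i]) v :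
  (forall k, (fun j => complex.Re (f j k)) @ \oo --> complex.Re (v k)) ->
  (forall k, (fun j => complex.Im (f j k)) @ \oo --> complex.Im (v k)) ->
  (fun j => psum n (f j)) @ \oo --> psum n v.
Proof.
move=> cRe cIm; rewrite /psum; apply: cvg_big => [|i _]; first exact: add_continuous.
by rewrite /sqn; apply: cvgD; apply: cvgM.
Qed.
Opaque sqn.

End Psum.

(** * Banded operators on l2 *)

Section BandedOperators.
Variables (R : realType) (S : set int) (T : (int -> R[i]) -> int -> R[i]).
Variables (r : nat) (K0 : R).

Definition supp (v : int -> R[i]) := forall k, ~ S k -> v k = 0.

(** This is the full form <T v, v> as soon as the window contains the support of [v]. *)
Definition frm n (v : int -> R[i]) : R := win n (fun k => ip (T v k) (v k)).

Hypothesis K0_ge0 : 0 <= K0.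
Hypothesis TB : forall (u v : int -> R[i]) k, T (fun k => u k - v k) k = T u k - T v k.
Hypothesis TZ : forall (s : R) (v : int -> R[i]) k, T (fun k => s%:C%C * v k) k = s%:C%C * T v k.
(** Encodes band width [r] and boundedness at once, without matrix entries. *)
Hypothesis Tloc : forall v k, sqn (T v k) <= K0 * win r (fun m => sqn (v (k + m))).
Hypothesis TS : forall v, supp v -> supp (T v).

Let K1 : R := K0 * (2 * r).+1%:R.

(** Summing [Tloc] over the window counts each entry at most [2r + 1] times, so [K1] bounds the
    squared norm of [T]. *)
Lemma op_psum n v : psum n (T v) <= K1 * psum (n + r) v.
Proof.
apply: (@le_trans _ _ (K0 * win n (fun k => win r (fun m => sqn (v (k + m)))))).
  by rewrite psumE -winZ; apply: ler_win => k _; apply: Tloc.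
rewrite /K1 -mulrA; apply: ler_wpM2l => //; rewrite win_exchange -win_cst !psumE.
apply: ler_win => m mr.
apply: (@win_shift_le _ n (n + r) m (fun k => sqn (v k))); first by lia.
by move=> k; apply: sqn_ge0.
Qed.

(** By linearity [Tloc] applies to [u - v], which vanishes near [k]. This carries estimates from
    finitely supported vectors over to l2 by truncation. *)
Lemma op_local u v k : (forall m, (`|m| <= r)%N -> u (k + m) = v (k + m)) ->
  T u k = T v k.
Proof.
move=> uv; apply/eqP; rewrite -subr_eq0 -TB; apply/eqP/sqn_eq0/le_anti.
rewrite sqn_ge0 andbT; apply: le_trans (Tloc _ _) _.
by rewrite (@eq_win _ r _ (fun=> 0)) ?win0 ?mulr0 // => m /uv ->; rewrite subrr sqn0.
Qed.

Lemma op0 k : T (fun=> 0) k = 0.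
Proof. by have := TB (fun=> 0) (fun=> 0) k; rewrite !subrr. Qed.

Lemma op_fin n v : fin n v -> fin (n + r) (T v).
Proof.
move=> vn k kn; rewrite -(op0 k); apply: op_local => m mr.
by apply: vn; lia.
Qed.

Lemma frm_fin n N v : (n <= N)%N -> fin n v -> frm N v = frm n v.
Proof. by move=> nN vn; apply: win_eq => // k /vn ->; rewrite ip0r. Qed.

Lemma supp_trunc n v : supp v -> supp (trunc n v).
Proof. by move=> vS k /vS vk; rewrite /trunc vk if_same. Qed.

(** * Inverting a coercive operator by Richardson iteration *)

Section Coercive.
Variable c K : R.
Hypothesis c_gt0 : 0 < c.
Hypothesis K_ge : c ^+ 2 <= K.
Hypothesis K1_le : K1 <= K.
Hypothesis Tco : forall n w, supp w -> fin n w -> c * psum n w <= frm n w.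

Let K_gt0 : 0 < K. Proof. by apply: lt_le_trans K_ge; rewrite exprn_gt0. Qed.

(** This step minimises 1 - 2 s c + s^2 K, with minimum [q]; [K_ge] keeps [q] nonnegative. *)
Let s : R := c / K.
Let q : R := 1 - c ^+ 2 / K.
Let P (v : int -> R[i]) k := v k - s%:C%C * T v k.

Let q_itv : 0 <= q < 1.
Proof.
rewrite subr_ge0 ler_pdivrMr // mul1r K_ge /= gtrBl divr_gt0 //.
exact: exprn_gt0.
Qed.

(* With step [s = c / K], [|w - s T w|^2 <= (1 - 2 s c + s^2 K) |w|^2]. *)
Let step_fin n N w : supp w -> fin n w -> psum N (P w) <= q * psum n w.
Proof.
move=> wS wn; apply: (@le_trans _ _ (psum (N + n) (P w))).
  by apply: psum_le; rewrite leq_addr.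
rewrite psumE (@eq_win _ _ _ (fun k => sqn (w k) - 2 * s * ip (T w k) (w k) +
  s ^+ 2 * sqn (T w k))); last first.
  by move=> k _; rewrite sqnB ipZr sqnZ (ipC (w k)) mulrA.
rewrite winD winB !winZ -!psumE -/(frm _ w).
rewrite (psum_fin _ wn) ?leq_addl // (frm_fin _ wn) ?leq_addl //.
have H1 := Tco wS wn.
have H2 : psum (N + n) (T w) <= K * psum n w.
  apply: le_trans (op_psum _ _) _; rewrite (psum_fin _ wn); last by lia.
  by apply: ler_wpM2r; rewrite ?psum_ge0.
have s0 : 0 <= s by rewrite divr_ge0 // ltW.
have H3 : 2 * s * (c * psum n w) <= 2 * s * frm n w.
  by apply: ler_wpM2l => //; apply: mulr_ge0.
have H4 : s ^+ 2 * psum (N + n) (T w) <= s ^+ 2 * (K * psum n w).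
  by apply: ler_wpM2l => //; apply: sqr_ge0.
have E : q * psum n w = psum n w - 2 * s * (c * psum n w) + s ^+ 2 * (K * psum n w).
  by rewrite /q /s; field; rewrite gt_eqF.
by rewrite E; lra.
Qed.

(** On the window [n], [P v] depends only on the entries of [v] in the window [n + r], so [v] may be
    truncated there. *)
Let step n v : supp v -> psum n (P v) <= q * psum (n + r) v.
Proof.
move=> vS; rewrite -(psum_trunc (n + r) v).
rewrite (@eq_psum _ n _ (P (trunc (n + r) v))).
  by apply: step_fin; [exact: supp_trunc|exact: trunc_fin].
move=> k kn; rewrite /P (@op_local v (trunc (n + r) v)) /trunc; last first.
  by move=> m mr; case: ifP => //; lia.
by case: ifP => //; lia.
Qed.

Let bounded_step v B : supp v -> (forall n, psum n v <= B) ->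
  forall n, psum n (P v) <= q * B.
Proof.
move=> vS vB n; apply: le_trans (step _ vS) _; apply: ler_wpM2l => //.
by case/andP: q_itv.
Qed.

Lemma cvg_geom0 (B : R) : (fun n => B * q ^+ n) @ \oo --> 0.
Proof.
rewrite -[X in _ --> X](mulr0 B); apply: cvgM; first exact: cvg_cst.
by apply: cvg_expr; case/andP: q_itv => *; rewrite ger0_norm.
Qed.

(** If [T v = 0] then [P v = v], so the bound [B] improves by a factor [q] at every iteration. *)
Lemma coercive_inj v B : supp v -> (forall n, psum n v <= B) ->
  (forall k, T v k = 0) -> forall k, v k = 0.
Proof.
move=> vS vB Tv k.
have vq j : forall n, psum n v <= B * q ^+ j.
  elim: j => [|j IH] n; first by rewrite mulr1.
  rewrite exprS mulrCA -(@eq_psum _ _ (P v)); first exact: bounded_step.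
  by move=> i _; rewrite /P Tv mulr0 subr0.
apply/sqn_eq0/le_anti; rewrite sqn_ge0 andbT.
apply: (cvgr_to_ge (cvg_geom0 B)); apply: nearW => j.
by apply: le_trans (vq j `|k|%N); apply: psum_ge_term.
Qed.

Fixpoint richardson (w : int -> R[i]) n : int -> R[i] :=
  if n is n'.+1 then
    fun k => richardson w n' k - s%:C%C * (T (richardson w n') k - w k)
  else fun=> 0.

Section Iterates.
Variables (w : int -> R[i]) (wS : supp w).
Let u := richardson w.
Let d n k := T (u n) k - w k.

Let uS n : supp (u n).
Proof.
elim: n => [//|n IH] k Sk; rewrite /u /= -/u IH // (TS (IH)) // wS //.
by rewrite subrr mulr0 subrr.
Qed.

Let dS n : supp (d n).
Proof. by move=> k Sk; rewrite /d (TS (@uS n)) // wS // subrr. Qed.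

(** The residual is multiplied by 1 - s T at each step; its geometric decay follows. *)
Let dP n k : d n.+1 k = P (d n) k.
Proof.
rewrite /P {1}/d /u /= -/u TB TZ; set y := _ * T _ k.
by rewrite [LHS]addrAC /d.
Qed.

Let d_psum B : (forall n, psum n w <= B) ->
  forall j n, psum n (d j) <= B * q ^+ j.
Proof.
move=> wB; elim=> [|j IH] n.
  rewrite mulr1 (@eq_psum _ n _ (fun k => - w k)) ?psumN // => k _.
  by rewrite /d /u /= op0 sub0r.
rewrite exprS mulrCA (@eq_psum _ n _ (P (d j))); first exact: bounded_step.
by move=> k _; apply: dP.
Qed.

Let al : R := c ^+ 2 / K / 2.
(** Fixed point of the affine map sending x to (1 - al) x + (1 + al^-1) s^2, which controls |u j|^2
    relative to |w|^2; here 2 al = 1 - q. *)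
Definition inverse_bound : R := (1 + al^-1) * s ^+ 2 / al.

Let al_gt0 : 0 < al.
Proof. by rewrite !divr_gt0 ?exprn_gt0. Qed.

Let qal : (1 + al) * q <= 1 - al.
Proof.
have -> : q = 1 - 2 * al by rewrite /q /al; field; rewrite gt_eqF.
by have := sqr_ge0 al; rewrite expr2; nra.
Qed.

Let u_psum B : (forall n, psum n w <= B) ->
  forall j n, psum n (u j) <= inverse_bound * B.
Proof.
move=> wB; have B0 : 0 <= B by apply: le_trans (wB 0%N); apply: psum_ge0.
have ib0 : 0 <= inverse_bound.
  by rewrite divr_ge0 ?mulr_ge0 ?sqr_ge0 ?addr_ge0 ?invr_ge0 // ltW.
elim=> [|j IH] n.
  rewrite (@eq_psum _ n _ (fun=> 0)) // psumE.
  rewrite (@eq_win _ n _ (fun=> 0)) => [|k _]; last exact: sqn0.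
  by rewrite win0; apply: mulr_ge0.
(* The next iterate is [P (u j) + s w]; the cross term is split by Young's inequality with weight
   [al]. *)
have H k : sqn (u j.+1 k) <=
    (1 + al) * sqn (P (u j) k) + (1 + al^-1) * s ^+ 2 * sqn (w k).
  have -> : u j.+1 k = P (u j) k - (- s)%:C%C * w k.
    by rewrite /u /= -/u /P rmorphN; ring.
  move: (P (u j) k) => p; have := ip_young p (s%:C%C * w k) al_gt0.
  by rewrite sqnB !ipZr !sqnZ sqrrN; lra.
have H1 : psum n (u j.+1) <=
    (1 + al) * psum n (P (u j)) + (1 + al^-1) * s ^+ 2 * psum n w.
  by rewrite !psumE -!winZ -winD; apply: ler_win => k _.
apply: le_trans H1 _.
have H2 : (1 + al) * psum n (P (u j)) <= (1 - al) * (inverse_bound * B).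
  apply: (@le_trans _ _ ((1 + al) * (q * (inverse_bound * B)))).
    by apply: ler_wpM2l; [rewrite addr_ge0 // ltW|apply: bounded_step].
  by rewrite mulrA; apply: ler_wpM2r => //; apply: mulr_ge0.
have H3 : (1 + al^-1) * s ^+ 2 * psum n w <= (1 + al^-1) * s ^+ 2 * B.
  have al1 : 0 <= 1 + al^-1 by rewrite addr_ge0 // invr_ge0 ltW.
  by apply: ler_wpM2l => //; apply: mulr_ge0 => //; apply: sqr_ge0.
have E : inverse_bound * B = (1 - al) * (inverse_bound * B) + (1 + al^-1) * s ^+ 2 * B.
  by rewrite /inverse_bound; field; rewrite gt_eqF.
by rewrite E; apply: lerD.
Qed.

(** Increments are [s] times residuals, so the iterates converge entrywise, and norm bounds pass to
    the limit. [B0] serves convergence only; the constant in the final bound does not depend on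
    [w]. *)
Lemma coercive_surj B0 : (forall n, psum n w <= B0) ->
  exists v, [/\ supp v, forall k, T v k = w k &
    forall B, (forall n, psum n w <= B) -> forall n, psum n v <= inverse_bound * B].
Proof.
move=> wB.
have B00 : 0 <= B0 by apply: le_trans (wB 0%N); apply: psum_ge0.
have incr k j : sqn (u j.+1 k - u j k) <= s ^+ 2 * B0 * q ^+ j.
  rewrite /u /= -/u [_ - u j k]addrAC subrr sub0r sqnN sqnZ -mulrA.
  apply: ler_wpM2l; rewrite ?sqr_ge0 //.
  exact: le_trans (psum_ge_term _ (leqnn _)) (d_psum wB _ _).
have sB : 0 <= s ^+ 2 * B0 by rewrite mulr_ge0 ?sqr_ge0.
have cRe k : cvgn (fun j => complex.Re (u j k)).
  apply: (cvg_geometric_increments q_itv sB) => j; apply: le_trans (incr k j).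
  exact: sqr_ReB_le.
have cIm k : cvgn (fun j => complex.Im (u j k)).
  apply: (cvg_geometric_increments q_itv sB) => j; apply: le_trans (incr k j).
  exact: sqr_ImB_le.
pose v k : R[i] := (limn (fun j => complex.Re (u j k)) +i*
                    limn (fun j => complex.Im (u j k)))%C.
(* [T v - w] is split into [T (v - u j)] and the residual [d j]. By locality the first needs only
   entrywise convergence on a finite window. *)
have cv k : sqn (T v k - w k) <= 0.
  have c0 : (fun j => 2 * (K1 * psum (`|k| + r) (fun k => v k - u j k)) +
      2 * (B0 * q ^+ j)) @ \oo --> 0.
    rewrite -[X in _ --> X](addr0 0); apply: cvgD.
      rewrite -[X in _ --> X](mulr0 2); apply: cvgM; first exact: cvg_cst.
      rewrite -[X in _ --> X](mulr0 K1); apply: cvgM; first exact: cvg_cst.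
      rewrite (_ : 0 = psum (`|k| + r) (fun k => v k - v k)); last first.
        rewrite psumE (@eq_win _ _ _ (fun=> 0)) ?win0 // => i _.
        by rewrite subrr sqn0.
      apply: cvg_psum => i.
        rewrite ReB; under eq_cvg do rewrite ReB.
        by apply: cvgB; [exact: cvg_cst|exact: cRe].
      rewrite ImB; under eq_cvg do rewrite ImB.
      by apply: cvgB; [exact: cvg_cst|exact: cIm].
    rewrite -[X in _ --> X](mulr0 2); apply: cvgM; first exact: cvg_cst.
    exact: cvg_geom0.
  apply: (cvgr_to_ge c0); apply: nearW => j.
  have -> : T v k - w k = T (fun k => v k - u j k) k - - d j k.
    by rewrite TB opprK /d addrA subrK.
  apply: le_trans (sqnB_le _ _) _; rewrite sqnN; apply: lerD; apply: ler_wpM2l => //.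
    exact: le_trans (psum_ge_term _ (leqnn _)) (op_psum _ _).
  exact: le_trans (psum_ge_term _ (leqnn _)) (d_psum wB _ _).
exists v; split.
- move=> k Sk; rewrite /v; have u0 j : u j k = 0 by apply: uS.
  under eq_fun do rewrite u0; under [in X in (_ +i* X)%C]eq_fun do rewrite u0.
  by rewrite !lim_cst.
- move=> k; apply/eqP; rewrite -subr_eq0; apply/eqP/sqn_eq0/le_anti.
  by rewrite cv sqn_ge0.
- move=> B wB' n.
  have cvn : (fun j => psum n (u j)) @ \oo --> psum n v by apply: cvg_psum.
  apply: (cvgr_to_le cvn); apply: nearW => j; exact: u_psum.
Qed.

End Iterates.

(** [G] selects a solution by [coercive_surj], hence is a right inverse; [G (T v) - v] lies in the
    kernel of [T], so injectivity makes it a left inverse. *)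
Lemma coercive_inverse : exists G : (int -> R[i]) -> (int -> R[i]),
    (forall v, l2 S v -> l2 S (G v)) /\
    (forall v, l2 S v -> G (T v) = v) /\
    (forall v, l2 S v -> T (G v) = v) /\
    (exists C : R, forall v, l2 S v -> forall B : R,
        (forall n, psum n v <= B) -> forall n, psum n (G v) <= C * B).
Proof.
have /choice[G GP] w : exists v, l2 S w -> [/\ supp v, forall k, T v k = w k &
    forall B, (forall n, psum n w <= B) -> forall n, psum n v <= inverse_bound * B].
  have [[wS [B wB]]|nw] := pselect (l2 S w); last by exists w => /nw.
  by have [v vP] := coercive_surj wS wB; exists v => _.
have l2G v : l2 S v -> l2 S (G v).
  move=> vl2; have [GS _ GB] := GP _ vl2; split=> //.
  by case: vl2 => _ [B /GB]; exists (inverse_bound * B).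
have l2T v : l2 S v -> l2 S (T v).
  move=> [vS [B vB]]; split; first exact: TS.
  exists (K * B) => n; apply: le_trans (op_psum _ _) _.
  by apply: ler_pM; rewrite ?psum_ge0 // /K1 mulr_ge0.
exists G; split=> //; split; last split.
- move=> v vl2; apply/funext => k; apply/eqP; rewrite -subr_eq0; apply/eqP.
  have [GS GE _] := GP _ (l2T _ vl2); case: (l2G _ (l2T _ vl2)) => _ [B1 GB].
  case: vl2 => vS [B2 vB].
  apply: (@coercive_inj (fun k => G (T v) k - v k) (2 * B1 + 2 * B2)).
  + by move=> i Si; rewrite GS // vS // subrr.
  + move=> n; apply: (@le_trans _ _ (2 * psum n (G (T v)) + 2 * psum n v)).
      by rewrite !psumE -!winZ -winD; apply: ler_win => i _; apply: sqnB_le.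
    by apply: lerD; apply: ler_wpM2l.
  + by move=> i; rewrite TB GE subrr.
- by move=> v vl2; apply/funext; have [] := GP _ vl2.
- by exists inverse_bound => v /GP[].
Qed.

End Coercive.

(** * Coercivity of positive operators with bounded inverse *)

Section Positive.
Hypothesis T_ge0 : forall n w, supp w -> fin n w -> 0 <= frm n w.
Hypothesis Tsym : forall n u v, fin n u -> fin n v ->
  win (n + r) (fun k => ip (T u k) (v k)) = win (n + r) (fun k => ip (u k) (T v k)).

(* Positivity at [w - s T w] gives [s |T w|^2 <= <T w, w>] for small [s]. *)
Lemma positive_op_le n w : supp w -> fin n w ->
  2 / (K1 + 1) * psum (n + r) (T w) <= frm n w.
Proof.
move=> wS wn; set s := 2 / (K1 + 1).
have K10 : 0 <= K1 by rewrite /K1 mulr_ge0.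
have s0 : 0 < s by rewrite divr_gt0 // ltr_wpDl.
pose N := (n + r + r)%N.
have Twn := op_fin wn.
have wN : fin (n + r) w by move=> k ?; apply: wn; lia.
pose z k := w k - s%:C%C * T w k.
have zS : supp z by move=> k Sk; rewrite /z wS // (TS wS) // mulr0 subrr.
have zn : fin (n + r) z by move=> k kn; rewrite /z wN // Twn // mulr0 subrr.
have := T_ge0 zS zn; rewrite -(frm_fin (leq_addr r _) zn) /frm.
rewrite (@eq_win _ _ _ (fun k => ip (T w k) (w k) - s * sqn (T w k)
  - s * ip (T (T w) k) (w k) + s ^+ 2 * ip (T (T w) k) (T w k))); last first.
  by move=> k _; rewrite /z TB TZ ipBl !ipBr !ipZl !ipZr -sqnE; ring.
rewrite winD !winB !winZ -psumE (Tsym Twn wN).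
have -> : win N (fun k => ip (T w k) (T w k)) = psum N (T w).
  by rewrite psumE; apply: eq_win => k _; rewrite sqnE.
rewrite -!/(frm _ _) (psum_fin _ Twn) ?leq_addr //.
rewrite (frm_fin (_ : (n <= N)%N) wn); last by rewrite /N; lia.
(* With [s = 2 / (K1 + 1)], the term quadratic in [s] cancels at most one of the two copies of s |T
   w|^2 gained from the linear terms. *)
have H : 2 * win N (fun k => ip (T (T w) k) (T w k)) <= (K1 + 1) * psum (n + r) (T w).
  apply: (@le_trans _ _ (psum N (T (T w)) + psum N (T w))).
    by rewrite !psumE -winD -winZ; apply: ler_win => k _; apply: ip_le.
  rewrite (psum_fin _ Twn) ?leq_addr // mulrDl mul1r; apply: lerD => //.
  apply: le_trans (op_psum _ _) _; rewrite (psum_fin _ Twn) // /N; lia.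
have H2 : s ^+ 2 * win N (fun k => ip (T (T w) k) (T w k)) <= s * psum (n + r) (T w).
  have -> : s * psum (n + r) (T w) = s ^+ 2 / 2 * ((K1 + 1) * psum (n + r) (T w)).
    by rewrite /s; field; rewrite gt_eqF // ltr_wpDl.
  have -> : s ^+ 2 * win N (fun k => ip (T (T w) k) (T w k)) =
     s ^+ 2 / 2 * (2 * win N (fun k => ip (T (T w) k) (T w k))) by field.
  by rewrite ler_wpM2l // divr_ge0 ?sqr_ge0.
by move: H2; rewrite -/(frm N (T w)) /N => H2; lra.
Qed.

(** Since [w = G (T w)], |w|^2 is at most C |T w|^2, which [positive_op_le] bounds by the form. *)
Lemma positive_invertible_coercive (G : (int -> R[i]) -> (int -> R[i])) (C : R) :
  (forall v, l2 S v -> G (T v) = v) ->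
  (forall v, l2 S v -> forall B : R,
     (forall n, psum n v <= B) -> forall n, psum n (G v) <= C * B) ->
  exists2 e : R, 0 < e & forall n w, supp w -> fin n w -> e * psum n w <= frm n w.
Proof.
move=> GT GC; set s := 2 / (K1 + 1).
have s0 : 0 < s by rewrite divr_gt0 // ltr_wpDl // /K1 mulr_ge0.
(* [C] is not assumed positive, hence the maximum. *)
pose C' := Num.max C 1.
have C'0 : 0 < C' by rewrite lt_max ltr01 orbT.
exists (s / C'); first exact: divr_gt0.
move=> n w wS wn; have Twn := op_fin wn.
apply: le_trans (positive_op_le wS wn); rewrite -/s -mulrA ler_pM2l //.
rewrite ler_pdivrMl //; apply: (@le_trans _ _ (C * psum (n + r) (T w))).
  have wl2 : l2 S w.
    by split=> //; exists (psum n w) => m; apply: psum_fin_le.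
  rewrite -{1}(GT _ wl2); apply: GC; last by move=> m; apply: psum_fin_le.
  by split; [exact: TS|exists (psum (n + r) (T w)) => m; apply: psum_fin_le].
by rewrite ler_wpM2r ?psum_ge0 // le_max lexx.
Qed.

End Positive.

End BandedOperators.

(** * Hermitian band matrices *)

Section BandMatrices.
Variable R : realType.
Implicit Types (a : int -> int -> R[i]) (w v : int -> R[i]).

Definition band r a v k : R[i] := \sum_(m <- wseq r) a k (k + m) * v (k + m).

Definition form_ge r (S : set int) a (t : R) :=
  forall n w, supp S w -> fin n w -> t * psum n w <= frm (band r a) n w.

Lemma frm_band r a n w :
  frm (band r a) n w = win n (fun k => win r (fun m => ip (a k (k + m) * w (k + m)) (w k))).
Proof. by apply: eq_win => k _; rewrite /band ip_suml. Qed.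

(** A Schur-type bound. Entries are controlled only where [w] is nonzero at both ends: in the
    comparison of two potentials they are close only there. *)
Lemma band_form_norm r (C : R) (b : int -> int -> R[i]) n w : 0 < C -> fin n w ->
  (forall k m, (`|m| <= r)%N -> w (k + m) != 0 -> w k != 0 -> sqn (b k m) <= C ^+ 2) ->
  win n (fun k => win r (fun m => `|ip (b k m * w (k + m)) (w k)|)) <=
  2 * C * (2 * r).+1%:R * psum n w.
Proof.
move=> C0 wn bC.
apply: (@le_trans _ _ (win n (fun k => win r (fun m =>
    C * (sqn (w (k + m)) + sqn (w k)))))).
  apply: ler_win => k _; apply: ler_win => m mr.
  have h0 : 0 <= C * (sqn (w (k + m)) + sqn (w k)).
    by apply: mulr_ge0; [exact: ltW|apply: addr_ge0; apply: sqn_ge0].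
  have [wkm|wkm] := eqVneq (w (k + m)) 0.
    by rewrite [X in ip (_ * X)]wkm mulr0 ip0l normr0.
  have [wk|wk] := eqVneq (w k) 0; first by rewrite [X in ip _ X]wk ip0r normr0.
  by apply: ip_norm_young => //; apply: bC.
rewrite win_exchange.
apply: (@le_trans _ _ (win r (fun=> 2 * C * psum n w))); last first.
  by rewrite win_cst mulrC mulrAC.
apply: ler_win => m mr; rewrite winZ winD.
rewrite (_ : 2 * C * psum n w = C * (2 * psum n w)); last by ring.
apply: ler_wpM2l; first exact: ltW.
suff : win n (fun k => sqn (w (k + m))) <= psum n w by rewrite psumE; lra.
rewrite -(@psum_fin _ n (n + `|m|)) ?leq_addr // psumE.
by apply: (@win_shift_le _ n _ m (fun k => sqn (w k))) => // k; apply: sqn_ge0.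
Qed.

(** * Lower bounds of the spectrum and of the quadratic form *)

Section Hermitian.
Variables (r : nat) (S : set int) (a : int -> int -> R[i]) (C : R).
Hypothesis C_gt0 : 0 < C.
Hypothesis a_le : forall k l, sqn (a k l) <= C ^+ 2.
Hypothesis a_herm : forall k l, a l k = (a k l)^*.
Hypothesis a_supp : forall k l, ~ S k -> a k l = 0.

Let T (t : R) v k := band r a v k - t%:C%C * v k.

(** First term: Cauchy-Schwarz over the [2r + 1] entries of a row. Second term: the scalar part. The
    factors 2 come from [sqnB_le]. *)
Let K0 (t : R) : R := 2 * ((2 * r).+1%:R * C ^+ 2) + 2 * t ^+ 2.

Let K0_ge0 t : 0 <= K0 t.
Proof.
by rewrite addr_ge0 // mulr_ge0 // ?sqr_ge0 // mulr_ge0 // sqr_ge0.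
Qed.

Let TB t (u v : int -> R[i]) k : T t (fun k => u k - v k) k = T t u k - T t v k.
Proof.
rewrite /T /band; under eq_bigr do rewrite mulrBr.
by rewrite sumrB; ring.
Qed.

Let TZ t (s : R) (v : int -> R[i]) k :
  T t (fun k => s%:C%C * v k) k = s%:C%C * T t v k.
Proof.
rewrite /T /band mulrBr mulr_sumr; congr (_ - _); last by rewrite mulrCA.
by apply: eq_bigr => m _; rewrite mulrCA.
Qed.

Let Tloc t v k : sqn (T t v k) <= K0 t * win r (fun m => sqn (v (k + m))).
Proof.
set W := win r _; have -> : K0 t * W =
    2 * ((2 * r).+1%:R * (C ^+ 2 * W)) + 2 * (t ^+ 2 * W) by rewrite /K0; ring.
apply: le_trans (sqnB_le _ _) _; rewrite sqnZ; apply: lerD.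
  apply: ler_wpM2l => //; apply: le_trans (sqn_sum _ _) _; rewrite size_wseq.
  apply: ler_wpM2l => //; rewrite -winZ.
  rewrite -/(win r (fun m => sqn (a k (k + m) * v (k + m)))); apply: ler_win => m _.
  by rewrite sqnM; apply: ler_wpM2r; rewrite ?sqn_ge0.
apply: ler_wpM2l => //; apply: ler_wpM2l; first exact: sqr_ge0.
rewrite -{1}[k]addr0.
by apply: (@win_ge_term _ r 0 (fun m => sqn (v (k + m)))) => // m; apply: sqn_ge0.
Qed.

Let TS t v : supp S v -> supp S (T t v).
Proof.
move=> vS k Sk; rewrite /T vS // mulr0 subr0 /band big1 // => m _.
by rewrite a_supp // mul0r.
Qed.

Let frmT t n w : frm (T t) n w = frm (band r a) n w - t * psum n w.
Proof.
by rewrite psumE -winZ -winB; apply: eq_win => k _; rewrite /T ipBl ipZl sqnE.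
Qed.

(** Reversing the offset [m] and translating [k] by [m] exchanges the two double sums, up to
    [a_herm]. *)
Let Tsym t n u v : fin n u -> fin n v ->
  win (n + r) (fun k => ip (T t u k) (v k)) = win (n + r) (fun k => ip (u k) (T t v k)).
Proof.
move=> un vn.
under eq_win do rewrite /T ipBl ipZl; under [RHS]eq_win do rewrite /T ipBr ipZr.
rewrite !winB; congr (_ - _).
rewrite (@eq_win _ _ _ (fun k => win r (fun m => ip (a k (k + m) * u (k + m)) (v k))));
  last by move=> k _; rewrite /band ip_suml.
rewrite win_exchange.
rewrite [RHS](@eq_win _ _ _ (fun k => win r (fun m => ip (u k) (a k (k + m) * v (k + m)))));
  last by move=> k _; rewrite ipC /band ip_suml; apply: eq_win => m _; rewrite ipC.
rewrite [RHS]win_exchange -[RHS]win_opp; apply: eq_win => m mr.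
pose F j := ip (u j) (a j (j - m) * v (j - m)).
have Fn k : (n < `|k|)%N -> F k = 0 by move=> /un uk; rewrite /F uk ip0l.
rewrite [RHS](@win_eq _ n _ F) ?leq_addr // -(@win_shift _ n (n + r) m F) //; last by lia.
by apply: eq_win => k _; rewrite /F addrK ip_conj -a_herm.
Qed.

Lemma form_ge_resolvent (c t : R) : form_ge r S a c -> t < c ->
  resolvent_pt S (band r a) (t%:C)%C.
Proof.
(* A sum of the two quantities that the constant [K] of the coercive case must dominate. *)
move=> ac tc; pose K := (c - t) ^+ 2 + K0 t * (2 * r).+1%:R.
have ct0 : 0 < c - t by rewrite subr_gt0.
have cK : (c - t) ^+ 2 <= K by rewrite lerDl mulr_ge0.
have K1K : K0 t * (2 * r).+1%:R <= K by rewrite lerDr sqr_ge0.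
apply: (coercive_inverse (K0_ge0 t) (@TB t) (@TZ t) (@Tloc t) (@TS t) ct0 cK K1K).
by move=> n w wS wn; rewrite frmT mulrBl lerD2r; apply: ac.
Qed.

(** At a resolvent point a lower bound of the form can be raised; hence the best lower bound belongs
    to the spectrum. *)
Lemma form_ge_improve (c : R) : form_ge r S a c ->
  resolvent_pt S (band r a) (c%:C)%C -> exists2 e : R, 0 < e & form_ge r S a (c + e).
Proof.
move=> ac [G [_ [GT [_ [CG GC]]]]].
have T0 n w : supp S w -> fin n w -> 0 <= frm (T c) n w.
  by move=> wS wn; rewrite frmT subr_ge0; apply: ac.
have [e e0 eP] := positive_invertible_coercive (K0_ge0 c) (@TB c) (@TZ c) (@Tloc c)
  (@TS c) T0 (@Tsym c) GT GC.
exists e => // n w wS wn; have := eP n w wS wn; rewrite frmT.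
by rewrite mulrDl; lra.
Qed.

Lemma form_ge_exists : form_ge r S a (- (2 * C * (2 * r).+1%:R)).
Proof.
move=> n w wS wn; rewrite mulNr lerNl.
apply: le_trans (band_form_norm (b := fun k m => a k (k + m)) C_gt0 wn _) => //.
rewrite frm_band -[- _]mulN1r -winZ; apply: ler_win => k _.
by rewrite -winZ; apply: ler_win => m _; rewrite mulN1r -normrN; apply: ler_norm.
Qed.

Lemma form_ge_sup (E : set R) : E !=set0 -> (forall t, E t -> form_ge r S a t) ->
  form_ge r S a (sup E).
Proof.
move=> E0 aE n w wS wn; have [p0|p0] := eqVneq (psum n w) 0.
  by case: E0 => t /aE/(_ n w wS wn); rewrite p0 !mulr0.
have pgt : 0 < psum n w by rewrite lt0r p0 psum_ge0.
rewrite -ler_pdivlMr //; apply: ge_sup => // t /aE/(_ n w wS wn).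
by rewrite ler_pdivlMr.
Qed.

Lemma form_ge_le (t t' : R) : t' <= t -> form_ge r S a t -> form_ge r S a t'.
Proof.
move=> tt at_ n w wS wn; apply: le_trans (at_ n w wS wn).
by rewrite ler_wpM2r ?psum_ge0.
Qed.

(** If [t0] is not a lower bound of the form, the best bound [sup E] is attained and lies below
    [t0]. It is then a resolvent point and can be raised, a contradiction. *)
Lemma spectrum_ge_form (t0 : R) :
  (forall t : R, spectrum S (band r a) (t%:C)%C -> t0 <= t) <-> form_ge r S a t0.
Proof.
split=> [sp|at0 t spt]; last first.
  by rewrite leNgt; apply/negP => /(form_ge_resolvent at0).
apply: contrapT => nat0.
pose E := [set t | form_ge r S a t].
have E0 : E !=set0 by exists (- (2 * C * (2 * r).+1%:R)); exact: form_ge_exists.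
have Eub : ubound E t0.
  move=> t Et; rewrite leNgt; apply/negP => /ltW tt.
  exact: nat0 (form_ge_le tt Et).
have aE : form_ge r S a (sup E) by apply: form_ge_sup.
have Et0 : sup E < t0.
  rewrite lt_neqAle ge_sup // andbT; apply/eqP => Et0.
  by apply: nat0; rewrite -Et0.
have : resolvent_pt S (band r a) ((sup E)%:C)%C.
  by apply: contrapT => /sp; rewrite leNgt Et0.
case/(form_ge_improve aE) => e e0 Ee.
have := ub_le_sup (ex_intro _ t0 Eub) Ee; rewrite gerDl => /le_lt_trans/(_ e0).
by rewrite ltxx.
Qed.

(** * Cutting vectors to windows and averaging *)

Definition clip (b : int) (L : nat) w k := if (b <= k < b + L%:Z)%R then w k else 0.

Lemma clip_fin b L n w : fin n w -> fin n (clip b L w).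
Proof. by move=> wn k /wn wk; rewrite /clip wk if_same. Qed.

Let clipE b L w k : clip b L w k = ((b <= k < b + L%:Z)%R%:R : R)%:C%C * w k.
Proof. by rewrite /clip; case: ifP; rewrite ?mul1r ?mul0r. Qed.

(* Averaging over all translates of a window of length [L] multiplies the entry
   at distance [m] from the diagonal by [L - |m|]. *)
Lemma sum_clip_form n (L : nat) w : (r <= L)%N -> fin n w ->
  win (n + 2 * L) (fun b => frm (band r a) n (clip b L w)) =
  win n (fun k => win r (fun m =>
    (L%:R - `|m|%:R) * ip (a k (k + m) * w (k + m)) (w k))).
Proof.
move=> rL wn.
rewrite (@eq_win _ _ _ (fun b => win n (fun k => win r (fun m =>
    ip (a k (k + m) * w (k + m)) (w k) *
      ((b <= k < b + L%:Z) && (b <= k + m < b + L%:Z))%R%:R)))); last first.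
  move=> b _; rewrite frm_band; apply: eq_win => k _; apply: eq_win => m _.
  rewrite !clipE mulrCA ipZl ipZr.
  by case: (b <= k < _)%R; case: (b <= k + m < _)%R => /=; ring.
rewrite win_exchange; apply: eq_win => k kn; rewrite win_exchange.
apply: eq_win => m mr; rewrite winZ (@win_count _ n) // ?(leq_trans mr) //.
by rewrite mulrC.
Qed.

Lemma sum_clip_psum n (L : nat) w :
  win (n + 2 * L) (fun b => psum n (clip b L w)) = L%:R * psum n w.
Proof.
rewrite psumE -winZ.
rewrite (@eq_win _ _ _ (fun b => win n (fun k => sqn (w k) *
      ((b <= k < b + L%:Z) && (b <= k + 0 < b + L%:Z))%R%:R))); last first.
  move=> b _; rewrite psumE; apply: eq_win => k _.
  by rewrite addr0 andbb clipE sqnZ; case: (_ && _); rewrite ?expr1n ?expr0n ?mul1r ?mulr1 ?mul0r ?mulr0.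
rewrite win_exchange; apply: eq_win => k kn.
by rewrite winZ (@win_count _ n) // subr0 mulrC.
Qed.

(** Summed over [b], the squared norm gains a factor [L], while an entry at offset [m] gains
    [L - |m|]. The loss is at most [r] times the bound of [band_form_norm], and dividing by [L]
    gives the error. *)
Lemma clip_form_ge (t : R) n (L : nat) w : (0 < L)%N -> (r <= L)%N -> fin n w ->
  (forall b, t * psum n (clip b L w) <= frm (band r a) n (clip b L w)) ->
  (t - r%:R * (2 * C * (2 * r).+1%:R) / L%:R) * psum n w <= frm (band r a) n w.
Proof.
move=> L0 rL wn clipP.
have L0' : 0 < L%:R :> R by rewrite ltr0n.
have H : t * (L%:R * psum n w) <= win (n + 2 * L) (fun b => frm (band r a) n (clip b L w)).
  by rewrite -sum_clip_psum // -winZ; apply: ler_win => b _.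
rewrite sum_clip_form // in H.
have H2 : win n (fun k => win r (fun m =>
    (L%:R - `|m|%:R) * ip (a k (k + m) * w (k + m)) (w k))) <=
    L%:R * frm (band r a) n w +
    r%:R * win n (fun k => win r (fun m => `|ip (a k (k + m) * w (k + m)) (w k)|)).
  rewrite frm_band -!winZ -winD; apply: ler_win => k _.
  rewrite -!winZ -winD; apply: ler_win => m mr; rewrite mulrBl lerD2l.
  apply: le_trans (ler_norm _) _; rewrite normrN normrM ger0_norm //.
  by apply: ler_wpM2r => //; rewrite ler_nat.
have H3 := band_form_norm (b := fun k m => a k (k + m)) C_gt0 wn (fun k m _ _ _ => a_le k (k + m)).
have H4 : r%:R * win n (fun k => win r (fun m => `|ip (a k (k + m) * w (k + m)) (w k)|))
    <= r%:R * (2 * C * (2 * r).+1%:R * psum n w) by apply: ler_wpM2l.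
rewrite -(ler_pM2l L0') (_ : L%:R * (_ * psum n w) =
   t * (L%:R * psum n w) - r%:R * (2 * C * (2 * r).+1%:R * psum n w)); last first.
  by field; rewrite gt_eqF.
by lra.
Qed.

End Hermitian.

End BandMatrices.

(** * Topology of the full shift *)

Section FullShift.
Variable A : finType.
Implicit Types (x y : cfg A) (k l : int).

Lemma tau_tau k l x : tau k (tau l x) = tau (k + l) x.
Proof. by apply/funext => j; rewrite /tau opprD addrA. Qed.

(** A cylinder at coordinate [w] pulls back to a cylinder at [w - k]. *)
Lemma tau_continuous k : continuous (@tau A k).
Proof.
move=> x U [] P [] [] Q QfinP <- [] V JV Vpz.
move/(@preimage_subset _ _ (tau k))/filterS; apply.
apply: (@filterS _ _ _ (tau k @^-1` V)); first by exists V.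
have [L Lsub /[dup] VL <-] := QfinP _ JV; rewrite preimage_bigcap.
apply: filter_bigI => /= M /[dup] LM /Lsub /set_mem [] w _ [+] + /[dup] + <-.
move=> N oN NM.
apply: (@proj_continuous int (fun=> discrete_topology A) (w - k) x N).
apply: open_nbhs_nbhs; split => //; move: Vpz.
by rewrite -VL => /(_ _ LM); rewrite -NM.
Qed.

Lemma cfg_compact : compact [set: cfg A].
Proof.
have -> : [set: cfg A] = [set f | forall i : int, [set: discrete_topology A] (f i)].
  by apply/seteqP; split.
apply: (@tychonoff int (fun=> discrete_topology A) (fun=> setT)) => i.
exact/finite_compact/(@finite_finset A).
Qed.

Lemma filter_all_seq (T : Type) (I : eqType) (F : set_system T) (s : seq I)
    (P : I -> set T) : Filter F ->
  (forall i, i \in s -> F (P i)) -> F [set y | forall i, i \in s -> P i y].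
Proof.
move=> FF; elim: s => [|j s IH] Ps; first by apply: filterE => y i.
apply: filterS2 (Ps j _) (IH _) => [y Pj Py i||i si]; rewrite ?inE ?eqxx //.
  by case/orP => [/eqP ->|/Py].
by apply: Ps; rewrite inE si orbT.
Qed.

End FullShift.

(** * Bounds on the potential and closeness of orbits under Fell convergence *)

Section Potentials.
Variables (R : realType) (A : finType) (X : set (cfg A)).
Variables (h : cfg A -> int -> R[i]) (r : nat).
Hypothesis X_closed : closed X.
Hypothesis X_inv : shift_invariant X.
Hypothesis h_cont : cont_on_XZ X h.

Lemma normc_sqn (z : R[i]) : `|z| = (Num.sqrt (sqn z))%:C%C.
Proof. exact: normc_def. Qed.

Lemma normc_lt_sqn (z : R[i]) (e : R) : 0 < e -> `|z| < e%:C%C -> sqn z < e ^+ 2.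
Proof.
move=> e0; rewrite normc_sqn ltcR => ze.
rewrite -[ltLHS]sqr_sqrtr ?sqn_ge0 // ltr_pXn2r // nnegrE ?sqrtr_ge0 //.
exact: ltW.
Qed.

Let X_compact : compact X.
Proof. exact: subclosed_compact X_closed (@cfg_compact A) (@subsetT _ _). Qed.

Lemma potential_bounded_at (m : int) : exists B : R, forall x, X x -> sqn (h x m) <= B.
Proof.
(* Near-covering form of compactness: a bound valid locally for all large [B] is valid on [X] for
   all large [B]. *)
have := (compact_near_coveringP X).1 X_compact R (pinfty_nbhs R)
  (fun B x => X x -> sqn (h x m) <= B) _.
case=> [x Xx|B [_ BP]].
  have [U [xU UP]] := h_cont m Xx ltr01.
  exists (U, [set B | 2 + 2 * sqn (h x m) <= B]); last first.
    move=> [y B] [/= Uy By] Xy; apply: le_trans By.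
    have -> : h y m = (h y m - h x m) - - h x m by rewrite opprK subrK.
    apply: le_trans (sqnB_le _ _) _; rewrite sqnN lerD2r.
    by have := normc_lt_sqn ltr01 (UP y Uy Xy); rewrite expr1n; lra.
  by split=> //=; apply: nbhs_pinfty_ge; rewrite num_real.
by exists (B + 1) => x Xx; apply: (BP (B + 1)) => //; rewrite /= ltrDl.
Qed.

Lemma potential_bounded : exists2 C : R, 0 < C &
  forall x m, X x -> (`|m| <= r)%N -> sqn (h x m) <= C ^+ 2.
Proof.
suff [B BP] : exists B : R, forall m, m \in wseq r -> forall x, X x -> sqn (h x m) <= B.
  exists (1 + `|B|); first by rewrite ltr_pwDl.
  move=> x m Xx; rewrite -mem_wseq => /BP/(_ x Xx)/le_trans; apply.
  apply: le_trans (ler_norm B) _; have := normr_ge0 B.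
  by rewrite expr2; nra.
elim: (wseq r) => [|m s [B BP]]; first by exists 0.
have [B' B'P] := potential_bounded_at m.
exists (Num.max B' B) => j; rewrite inE => /orP[/eqP ->|js] x Xx.
  by rewrite le_max B'P.
by rewrite le_max (BP j js) ?orbT.
Qed.

(** Compares only the potential values that a band operator of range [r] sees along an orbit
    segment. *)
Definition orbit_close (L : nat) (d : R) x y := forall k m, k \in wseq L -> m \in wseq r ->
  `|h (tau k y) m - h (tau k x) m| < d%:C%C.

(** Finitely many strict inequalities are involved; each leaves a slack [d - s] that continuity of
    [h] and [tau] can absorb. *)
Lemma orbit_close_nbhs L d x y : X y -> orbit_close L d x y ->
  nbhs y [set y' | X y' -> orbit_close L d x y'].
Proof.
move=> Xy xy.
have : nbhs y [set y' | forall k, k \in wseq L -> forall m, m \in wseq r ->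
    X y' -> `|h (tau k y') m - h (tau k x) m| < d%:C%C].
  apply: filter_all_seq => k kL; apply: filter_all_seq => m mr.
  have := xy k m kL mr; rewrite normc_sqn ltcR; set s := Num.sqrt _ => sd.
  have ds : 0 < d - s by rewrite subr_gt0.
  have [U [yU UP]] := h_cont m (X_inv k Xy) ds.
  have yU' : nbhs y (tau k @^-1` U) := @tau_continuous A k y U yU.
  apply: (@filterS _ _ _ (tau k @^-1` U)) => // y' Uy' Xy'.
  have -> : h (tau k y') m - h (tau k x) m =
      (h (tau k y') m - h (tau k y) m) + (h (tau k y) m - h (tau k x) m).
    by rewrite addrA subrK.
  apply: le_lt_trans (ler_normD _ _) _.
  rewrite [X in _ + X]normc_sqn -/s -[d](subrK s) rmorphD ltrD2r.
  by apply: UP => //; apply: X_inv.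
by apply: filterS => y' H Xy' k m kL mr; apply: H.
Qed.

(** The points of [X] not interior to the good set [W] form a compact set disjoint from [Xinf]. Fell
    convergence, tested with this compact set and no open sets, makes some [M i] avoid it. *)
Lemma fell_close (Xinf : set (cfg A)) (I : Type) (le : I -> I -> Prop)
    (M : I -> set (cfg A)) (L : nat) (d : R) :
  Xinf `<=` X -> (forall i, le i i) -> (forall i, M i `<=` X) ->
  fell_cvg X le M Xinf -> 0 < d ->
  exists i, forall y, M i y -> exists2 x, Xinf x & orbit_close L d x y.
Proof.
move=> XinfX lexx MX fell d0.
(* Points outside [X] are put in [W] so that interiors can be taken in the full shift. *)
pose W := [set y | X y -> exists2 x, Xinf x & orbit_close L d x y].
pose K := X `&` ~` W°.
have Kcl : closed K by apply: closedI => //; apply: open_closedC; apply: open_interior.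
have KX : K `<=` X by move=> y [].
have Kco : compact K by exact: subclosed_compact Kcl (@cfg_compact A) (@subsetT _ _).
have XK : Xinf `&` K = set0.
  apply/seteqP; split=> // y [Xiy [Xy]]; apply.
  have yy : orbit_close L d y y by move=> k m _ _; rewrite subrr normr0 ltcR.
  apply: filterS (orbit_close_nbhs Xy yy) => y' H Xy'.
  by exists y => //; apply: H.
have [//|//|i0 i0P] := fell K 0%N (fun=> set0) KX Kco _ XK.
exists i0 => y My; have [K0 _] := i0P i0 (lexx i0).
have Wy : (W°) y.
  apply: contrapT => nW.
  have : (M i0 `&` K) y by split=> //; split=> //; apply: MX My.
  by rewrite K0.
exact: interior_subset Wy (MX _ _ My).
Qed.

End Potentials.

(** * The operators H^N_x *)

Section Hop.
Variables (R : realType) (A : finType) (X : set (cfg A)).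
Variables (h : cfg A -> int -> R[i]) (r : nat).

Definition hmat (N : set (cfg A)) (x : cfg A) (k l : int) : R[i] :=
  if `[< Zx N x k >] && `[< Zx N x l >] then h (tau l x) (k - l) else 0.

Lemma Hop_band N x : Hop h r N x = band r (hmat N x).
Proof.
apply/funext => v; apply/funext => k; rewrite /Hop /band /wseq big_map.
rewrite (_ : iota 0 _ = index_iota 0 (2 * r).+1); last by rewrite /index_iota subn0.
rewrite big_mkord /hmat.
case: asboolP => _ /=; last by rewrite big1 // => j _; rewrite mul0r.
apply: eq_bigr => j _; rewrite -!addrA [- r%:Z + _]addrC.
by case: ifP; rewrite ?mul0r.
Qed.

Variable C : R.
Hypothesis C_gt0 : 0 < C.
Hypothesis h_le : forall x m, X x -> (`|m| <= r)%N -> sqn (h x m) <= C ^+ 2.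
Hypothesis h_range : forall (x : cfg A) (k : int), X x -> (r%:Z < `|k|)%R -> h x k = 0.
Hypothesis h_sa : self_adjoint X h.

Section Fixed.
Variables (N : set (cfg A)) (x : cfg A).
Hypothesis NX : N `<=` X.

Lemma hmat_le k l : sqn (hmat N x k l) <= C ^+ 2.
Proof.
rewrite /hmat; case: ifP => [/andP[/asboolP _ /asboolP Nl]|_]; last first.
  by rewrite sqn0 sqr_ge0.
have [kl|kl] := leqP (absz (k - l)%R) r; first by apply: h_le => //; apply: NX.
by rewrite h_range ?sqn0 ?sqr_ge0 //; apply: NX.
Qed.

Lemma hmat_herm k l : hmat N x l k = (hmat N x k l)^*.
Proof.
rewrite /hmat andbC; case: ifP => [/andP[/asboolP _ /asboolP Nl]|_]; last first.
  by rewrite conjC0.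
by rewrite -h_sa ?tau_tau ?subrK ?opprB //; apply: NX.
Qed.

Lemma hmat_supp k l : ~ Zx N x k -> hmat N x k l = 0.
Proof. by move=> Nk; rewrite /hmat asboolF. Qed.

Lemma inf_sp_geP (t : R) :
  (t%:E <= inf_sp h r N x)%E <-> form_ge r (Zx N x) (hmat N x) t.
Proof.
rewrite -(spectrum_ge_form r C_gt0 hmat_le hmat_herm hmat_supp) -Hop_band.
split=> [/ereal_infP H s sp|H].
  by rewrite -lee_fin; apply: H; exists s.
by apply/ereal_infP => _ [s sp <-]; rewrite lee_fin; apply: H.
Qed.

End Fixed.

(** The first error term is the cost of replacing the potential along a window by that of a point of
    [Xinf], the second the cost of averaging over windows. *)
Lemma local_form_ge (Xinf N : set (cfg A)) (L : nat) (d t : R) y :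
  Xinf `<=` X -> shift_invariant Xinf -> N `<=` X -> (0 < L)%N -> (r <= L)%N -> 0 < d ->
  (forall x, Xinf x -> form_ge r (Zx Xinf x) (hmat Xinf x) t) ->
  (forall z, N z -> exists2 x, Xinf x & orbit_close h r L d x z) ->
  form_ge r (Zx N y) (hmat N y)
    (t - 2 * d * (2 * r).+1%:R - r%:R * (2 * C * (2 * r).+1%:R) / L%:R).
Proof.
move=> XinfX XinfI NX L0 rL d0 Xinf_ge N_close n w wS wn.
apply: (clip_form_ge C_gt0 (hmat_le y NX)) => // b.
set v := clip b L w; have vn : fin n v := clip_fin b L wn.
(* A nonzero entry of the clipped vector supplies a base point [tau l0 y] in [N]; a zero vector is
   trivial. *)
have [[l0 vl0]|v0] := pselect (exists l0, v l0 != 0); last first.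
  have {}v0 k : v k = 0.
    by apply/eqP; apply: contrapT => /negP vk; apply: v0; exists k.
  rewrite psumE (@eq_win _ _ _ (fun=> 0)) => [|k _]; last by rewrite v0 sqn0.
  rewrite win0 mulr0 /frm (@eq_win _ _ _ (fun=> 0)) ?win0 // => k _.
  by rewrite v0 ip0r.
have vP k : v k != 0 -> Zx N y k /\ (b <= k < b + L%:Z)%R.
  rewrite /v /clip; case: ifP => [bk wk|_]; last by rewrite eqxx.
  by split=> //; apply: contrapT => /wS wk0; rewrite wk0 eqxx in wk.
have [Nl0 bl0] := vP _ vl0.
have [x Xx xy] := N_close _ Nl0.
(* Shifting back by [l0] aligns the orbits of [x'] and [y]. Sites of the window are at distance less
   than [L] from [l0], hence covered by [xy]. *)
pose x' := tau (- l0) x.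
have Xx' : Xinf x' by apply: XinfI.
have Zx' k : Zx Xinf x' k by apply: XinfI.
have vS' : supp (Zx Xinf x') v by move=> k /(_ (Zx' k)).
have H := Xinf_ge _ Xx' n v vS' vn.
suff D : frm (band r (hmat Xinf x')) n v - frm (band r (hmat N y)) n v <=
    2 * d * (2 * r).+1%:R * psum n v by rewrite mulrBl; lra.
pose D k m := hmat Xinf x' k (k + m) - hmat N y k (k + m).
apply: le_trans (band_form_norm (b := D) d0 vn _); last first.
  move=> k m mr /vP[Nkm bkm] /vP[Nk bk].
  rewrite /D /hmat !asboolT //=; apply/ltW/normc_lt_sqn => //.
  have -> : k - (k + m) = - m by rewrite opprD addNKr.
  rewrite distrC.
  have -> : tau (k + m) x' = tau (k + m - l0) x by rewrite tau_tau.
  have -> : tau (k + m) y = tau (k + m - l0) (tau l0 y) by rewrite tau_tau subrK.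
  by apply: xy; rewrite mem_wseq; lia.
rewrite !frm_band -winB; apply: ler_win => k _; rewrite -winB; apply: ler_win => m _.
by rewrite -ipBl -mulrBl; apply: ler_norm.
Qed.

End Hop.

(** * The identity for infima *)

Section InfPart.
Variables (R : realType) (A : finType) (X Xinf : set (cfg A)).
Variables (I : Type) (le : I -> I -> Prop) (M : I -> set (cfg A)).
Variables (h : cfg A -> int -> R[i]) (r : nat).
Hypothesis X_subshift : subshift X.
Hypothesis XinfX : Xinf `<=` X.
Hypothesis Xinf_inv : shift_invariant Xinf.
Hypothesis le_refl : forall i, le i i.
Hypothesis MX : forall i, M i `<=` X.
Hypothesis XinfM : forall i, Xinf `<=` M i.
Hypothesis M_cvg : fell_cvg X le M Xinf.
Hypothesis h_cont : cont_on_XZ X h.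
Hypothesis h_range : forall (x : cfg A) (k : int), X x -> (r%:Z < `|k|)%R -> h x k = 0.
Hypothesis h_sa : self_adjoint X h.

Lemma inf_sp_invariant i x : Xinf x -> inf_sp h r (M i) x = inf_sp h r Xinf x.
Proof.
move=> Xx; have ZX k : Zx Xinf x k by apply: Xinf_inv.
have ZE : Zx (M i) x = Zx Xinf x.
  by apply/seteqP; split=> k _ //; apply: XinfM; apply: ZX.
by rewrite /inf_sp !Hop_band /hmat ZE.
Qed.

Lemma approx_inf_sp (t e : R) : 0 < e ->
  (t%:E <= ereal_inf [set inf_sp h r Xinf x | x in Xinf])%E ->
  exists i, ((t - e)%:E <= ereal_inf [set inf_sp h r (M i) y | y in M i])%E.
Proof.
move=> e0 /ereal_infP tinf; have [Xcl Xinv] := X_subshift.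
have [C C0 hC] := potential_bounded r Xcl h_cont.
have Xinf_ge x : Xinf x -> form_ge r (Zx Xinf x) (hmat h Xinf x) t.
  move=> Xx; apply/(inf_sp_geP C0 hC h_range h_sa x XinfX).
  by apply: tinf; exists x.
set w : R := (2 * r).+1%:R; have w0 : 0 < w by rewrite ltr0n.
(* [d] makes the error from the potentials equal to [e / 2], and [L] is chosen so that the averaging
   error is at most [e / 2]. *)
pose d := e / (4 * w); have d0 : 0 < d by rewrite divr_gt0 // mulr_gt0.
pose B := r%:R * (2 * C * w); have B0 : 0 <= B by rewrite !mulr_ge0 // ltW.
pose L := ((Num.truncn (2 * B / e)).+1 + r)%N.
have L0 : (0 < L)%N by [].
have BL : B / L%:R <= e / 2.
  have : 2 * B / e < L%:R.
    apply: lt_le_trans (truncnS_gt _) _; rewrite ler_nat leq_addr //.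
  rewrite ltr_pdivrMr // ler_pdivrMr ?ltr0n // => /ltW; lra.
have [i iP] := fell_close r Xcl Xinv h_cont L XinfX le_refl MX M_cvg d0.
exists i; apply/ereal_infP => _ [y My <-].
apply/(inf_sp_geP C0 hC h_range h_sa y (@MX i)).
apply: form_ge_le (local_form_ge C0 hC h_range XinfX Xinf_inv (@MX i)
  L0 (leq_addl _ _) d0 Xinf_ge iP).
have -> : 2 * d * (2 * r).+1%:R = e / 2 by rewrite -/w /d; field; rewrite gt_eqF.
by rewrite -/w -/B; lra.
Qed.

Lemma inf_sp_eq : (ereal_inf [set inf_sp h r Xinf x | x in Xinf] =
  ereal_sup [set ereal_inf [set inf_sp h r (M i) y | y in M i] | i in [set: I]])%E.
Proof.
apply/eqP; rewrite eq_le; apply/andP; split; last first.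
  apply/ereal_supP => _ [i _ <-]; apply/ereal_infP => _ [x Xx <-].
  by rewrite -(inf_sp_invariant i) //; apply: ereal_inf_lbound; exists x => //; apply: XinfM.
set l := ereal_inf _; set u := ereal_sup _.
have H (t : R) : (t%:E <= l)%E -> (t%:E <= u)%E.
  move=> tl; apply/lee_subgt0Pr => e e0; have [i iP] := approx_inf_sp e0 tl.
  apply: le_trans iP _; apply: ereal_sup_ubound; exists i => //.
(* The value [+oo] occurs for instance when [Xinf] is empty; then [u] exceeds every real. *)
move: H; case: l => [l| |] H; first exact: H.
- by rewrite leye_eq; apply/eqP/eqyP => t _; apply: H; rewrite leey.
- by rewrite leNye.
Qed.

End InfPart.

(** * Spectra under change of sign *)

Section Opposite.
Variables (R : realType) (A : finType).

(** As -T - (-z) = -(T - z), the inverse is [G] precomposed with negation. *)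
Lemma resolvent_ptN (S : set int) (T : (int -> R[i]) -> int -> R[i]) (z : R[i]) :
  resolvent_pt S T z -> resolvent_pt S (fun v k => - T v k) (- z).
Proof.
move=> [G [Gl2 [GT [TG [C GC]]]]].
have l2N (v : int -> R[i]) : l2 S v -> l2 S (fun k => - v k).
  move=> [vS [B vB]]; split=> [k /vS ->|]; first by rewrite oppr0.
  by exists B => n; rewrite psumN.
exists (fun v => G (fun k => - v k)); split; first by move=> v /l2N/Gl2.
split; last split.
- move=> v vl2; rewrite -[RHS](GT _ vl2); congr G; apply/funext => k.
  by rewrite mulNr opprK opprD opprK.
- move=> v vl2; apply/funext => k; have /(congr1 (fun f => f k)) := TG _ (l2N _ vl2).
  by rewrite mulNr opprK => E; rewrite -[RHS]opprK -E opprB addrC.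
- exists C => v vl2 B vB n; apply: GC; first exact: l2N.
  by move=> j; rewrite psumN.
Qed.

Lemma spectrumN (S : set int) (T : (int -> R[i]) -> int -> R[i]) (z : R[i]) :
  spectrum S (fun v k => - T v k) z <-> spectrum S T (- z).
Proof.
split=> H /resolvent_ptN; first by rewrite opprK.
by under eq_fun do under eq_fun do rewrite opprK.
Qed.

Variables (h : cfg A -> int -> R[i]) (r : nat).

Lemma HopN N x : Hop (fun x k => - h x k) r N x = fun v k => - Hop h r N x v k.
Proof.
apply/funext => v; apply/funext => k; rewrite /Hop; case: ifP; rewrite ?oppr0 // => _.
by rewrite -sumrN; apply: eq_bigr => j _ /=; case: ifP; rewrite ?oppr0 ?mulNr.
Qed.

Lemma sup_spN N x : sup_sp h r N x = (- inf_sp (fun x k => - h x k)%R r N x)%E.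
Proof.
rewrite /sup_sp /inf_sp HopN ereal_supEN; congr (- ereal_inf _)%E.
apply/seteqP; split=> [_ [_ [t sp <-] <-]|_ [t /spectrumN sp <-]].
  by exists (- t) => //; apply/spectrumN; rewrite -rmorphN opprK.
exists (- t)%:E; last by rewrite -EFinN opprK.
by exists (- t) => //=; rewrite rmorphN.
Qed.

End Opposite.

(** * Both spectral identities for the net *)

Theorem theorem8p3 (R : realType) (A : finType) (X Xinf : set (cfg A))
    (I : Type) (le : I -> I -> Prop) (M : I -> set (cfg A))
    (h : cfg A -> int -> R[i]) (r : nat) :
  subshift X ->
  Xinf `<=` X -> closed Xinf -> shift_invariant Xinf ->
  directed_set le ->
  (forall i, clopen_in X (M i)) ->
  (forall i, Xinf `<=` M i) ->
  fell_cvg X le M Xinf ->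
  cont_on_XZ X h ->
  (forall (x : cfg A) (k : int), X x -> (r%:Z < `|k|)%R -> h x k = 0) ->
  self_adjoint X h ->
  (ereal_inf [set inf_sp h r Xinf x | x in Xinf] =
     ereal_sup [set ereal_inf [set inf_sp h r (M i) y | y in M i] | i in [set: I]])%E /\
  (ereal_sup [set sup_sp h r Xinf x | x in Xinf] =
     ereal_inf [set ereal_sup [set sup_sp h r (M i) y | y in M i] | i in [set: I]])%E.
Proof.
move=> Xsub XinfX _ Xinf_inv [_ [le_refl _]] Mclopen XinfM M_cvg h_cont h_range h_sa.
have MX i : M i `<=` X by have [] := Mclopen i.
split; first exact: (inf_sp_eq Xsub XinfX Xinf_inv le_refl MX XinfM M_cvg).
pose g x k : R[i] := - h x k.
have g_cont : cont_on_XZ X g.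
  move=> k x Xx e e0; have [U [xU UP]] := h_cont k x Xx e e0; exists U; split=> // y Uy Xy.
  by rewrite /g -opprD normrN; apply: UP.
have g_range (x : cfg A) (k : int) : X x -> (r%:Z < `|k|)%R -> g x k = 0.
  by move=> Xx rk; rewrite /g h_range ?oppr0.
have g_sa : self_adjoint X g by move=> x k Xx; rewrite /g h_sa // rmorphN.
have supN N : ereal_sup [set sup_sp h r N x | x in N] =
    (- ereal_inf [set inf_sp g r N x | x in N])%E.
  rewrite ereal_supEN image_comp; congr (- ereal_inf _)%E.
  by apply: eq_imagel => x _ /=; rewrite sup_spN oppeK.
rewrite supN (inf_sp_eq Xsub XinfX Xinf_inv le_refl MX XinfM M_cvg g_cont g_range g_sa).
rewrite ereal_infEN image_comp; congr (- ereal_sup _)%E.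
by apply: eq_imagel => i _ /=; rewrite supN oppeK.
Qed.
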